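(* Let $\boldsymbol{\gamma}=(\gamma_j)_{j\ge1}$ be a sequence of non-negative real numbers with $\gamma_1\ge\gamma_2\ge\cdots$, defining product weights $\gamma_{\mathfrak{u}}=\prod_{j\in\mathfrak{u}}\gamma_j$. Assume that there is a $0\le\delta<1/2$ such that $\limsup_{j\to\infty}j\gamma_j<\delta/3$. Then the weighted star discrepancy (or, equivalently, integration in $\mathcal{F}_1$) is strongly polynomially tractable with $\varepsilon$-exponent at most $2/(1-2\delta)$.
   Context: Notation: $[s]=\{1,\dots,s\}$; $\gamma_\emptyset=1$ (empty product). Weighted star discrepancy. For an $N$-element point set (multiset) $\mathcal{P}_s$ in $[0,1)^s$ and $\boldsymbol{\alpha}\in[0,1]^s$, let $\Delta_{\mathcal{P}_s}(\boldsymbol{\alpha})=\frac{|\mathcal{P}_s\cap[\boldsymbol{0},\boldsymbol{\alpha})|}{N}-\prod_{i=1}^s\alpha_i$. Then $$D^*_{N,\boldsymbol{\gamma}}(\mathcal{P}_s)=\max_{\emptyset\ne\mathfrak{u}\subseteq[s]}\gamma_{\mathfrak{u}}\sup_{\boldsymbol{\alpha}\in[0,1]^s}|\Delta_{\mathcal{P}_s}((\boldsymbol{\alpha}_{\mathfrak{u}},\boldsymbol{1}))|,$$ where $(\boldsymbol{\alpha}_{\mathfrak{u}},\boldsymbol{1})$ has $j$th coordinate $\alpha_j$ if $j\in\mathfrak{u}$ and $1$ otherwise. The information complexity $N(\varepsilon,s)$ of the weighted star discrepancy is the minimal $N\in\mathbb{N}$ for which there is an $N$-element point set $\mathcal{P}_s$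 in $[0,1)^s$ with $D^*_{N,\boldsymbol{\gamma}}(\mathcal{P}_s)\le\varepsilon$. Integration in $\mathcal{F}_1$. For each $s$, $\mathcal{F}_1$ is the space of functions $f$ on $[0,1]^s$ with finite norm $$\|f\|_{\mathcal{F}_1}=\sum_{\mathfrak{u}\subseteq[s]}\frac1{\gamma_{\mathfrak{u}}}\int_{[0,1]^{|\mathfrak{u}|}}\left|\frac{\partial^{|\mathfrak{u}|}f}{\partial\boldsymbol{x}_{\mathfrak{u}}}(\boldsymbol{x}_{\mathfrak{u}},\boldsymbol{1})\right|\,\mathrm{d}\boldsymbol{x}_{\mathfrak{u}},$$ where the term for $\mathfrak{u}=\emptyset$ is $|f(1,\dots,1)|$, and if $\gamma_{\mathfrak{u}}=0$ the corresponding derivative is required to vanish and the term is read as $0$. For a function space $\mathcal{F}$ on $[0,1]^s$ with norm $\|\cdot\|_{\mathcal{F}}$ put $$e(N,s)=\inf_{A_{N,s}}\ \sup_{f\in\mathcal{F},\ \|f\|_{\mathcal{F}}\le1}\left|\int_{[0,1]^s}f(\boldsymbol{x})\,\mathrm{d}\boldsymbol{x}-A_{N,s}(f)\right|,$$ the infimum being over all integration rules $A_{N,s}$ (not necessarily equal-weight) based on $N$ function evaluations $f(\boldsymbol{x}_0),\dots,f(\boldsymbol{x}_{N-1})$. The information complexity of integration in $\mathcal{F}$ is $N(\varepsilon,s)=\min\{N\in\mathbb{N}: e(N,s)\le\varepsilon\}$, $\varepsilon\in(0,1)$. Strong polynomial tractability means that there are non-negative numbers $C,\tau$ with $N(\varepsilon,s)\le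 C\varepsilon^{-\tau}$ for all $s\in\mathbb{N}$ and $\varepsilon\in(0,1)$. The ($\varepsilon$-)exponent of strong polynomial tractability is the infimum of those $\tau$ for which this holds. *)

(* Defs.v *)
From HB Require Import structures.
From mathcomp Require Import all_boot all_order all_algebra.
From mathcomp Require Import all_classical all_reals all_analysis.

Set Implicit Arguments.
Unset Strict Implicit.
Unset Printing Implicit Defensive.

Import Order.TTheory GRing.Theory Num.Theory.
Import numFieldNormedType.Exports.

Local Open Scope classical_set_scope.
Local Open Scope ring_scope.

Section lebesgue_tuple.
Variable R : realType.

Definition cons_pair n (p : R * n.-tuple R) : n.+1.-tuple R :=
  [tuple of p.1 :: p.2].

Lemma measurable_cons_pair n : measurable_fun [set: measurableTypeR R * n.-tuple R] (@cons_pair n).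
Proof. by apply: measurable_cons. Qed.

(** [n]-dimensional Lebesgue measure; the library has the product
    sigma-algebra on [n.-tuple R] but no [n]-fold product measure. *)
Fixpoint lebesgue_tuple n : set (n.-tuple R) -> \bar R :=
  if n is n'.+1 then
    pushforward (product_measure1 lebesgue_measure (@lebesgue_tuple n'))
                (@cons_pair n')
  else dirac [tuple].

Lemma lebesgue_tuple_measure n :
  exists m : {sigma_finite_measure set (n.-tuple R) -> \bar R},
    m = @lebesgue_tuple n :> (set (n.-tuple R) -> \bar R).
Proof.
elim: n => [|n [m mE]].
  by exists (dirac ([tuple] : 0.-tuple R)).
pose m0 : {sigma_finite_measure set (measurableTypeR R) -> \bar R} :=
  lebesgue_measure.
pose pm : {measure set (measurableTypeR R * n.-tuple R)%type -> \bar R} :=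
  (m0 \x m)%E.
pose q : {measure set (n.+1.-tuple R) -> \bar R} :=
  measure_function_pushforward__canonical__measure_function_Measure pm
    (@measurable_cons_pair n).
pose g (x : n.+1.-tuple R) : measurableTypeR R * n.-tuple R :=
  (thead x, [tuple of behead x]).
have mg : measurable_fun [set: n.+1.-tuple R] g.
  by apply/measurable_fun_pair => /=;
    [exact: measurable_tnth | exact: measurable_behead].
have gK : cancel (@cons_pair n) g.
  by move=> [a x]; rewrite /g /cons_pair; congr pair; exact/val_inj.
have qfin : sigma_finite setT q.
  have /sigma_finiteP[F [TF ndF Foo]] := sigma_finiteT m0.
  have /sigma_finiteP[G [TG ndG Goo]] := sigma_finiteT m.
  exists (fun k => g @^-1` (F k `*` G k)).
    rewrite -preimage_bigcup -[LHS](preimage_setT g); congr preimage.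
    rewrite -setXTT TF TG predeqE => -[x y]; split.
      move=> [/= [i _ Fx] [k _ Gy]]; exists (maxn i k) => //; split.
      - by move: x Fx; exact/subsetPset/ndF/leq_maxl.
      - by move: y Gy; exact/subsetPset/ndG/leq_maxr.
    by move=> [i _ []/= ? ?]; split; exists i.
  move=> k; have [mF Fk] := Foo k; have [mG Gk] := Goo k.
  split; first by rewrite -[X in measurable X]setTI; apply: mg => //; exact: measurableX.
  rewrite /q /= /pushforward -comp_preimage.
  rewrite (_ : g \o _ = id) ?preimage_id; last by apply/funext => x; exact: gK.
  by rewrite /pm /= product_measure1E// lte_mul_pinfty// ge0_fin_numE.
exists (HB.pack_for (SigmaFiniteMeasure.type (n.+1.-tuple R) R)
  (Measure.sort q) (Measure_isSigmaFinite.Build _ _ _ q qfin)).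
by rewrite /= -mE.
Qed.

Let lebesgue_tuple0 n : @lebesgue_tuple n set0 = 0%E.
Proof. by have [m <-] := lebesgue_tuple_measure n; exact: measure0. Qed.

Let lebesgue_tuple_ge0 n A : (0 <= @lebesgue_tuple n A)%E.
Proof. by have [m <-] := lebesgue_tuple_measure n; exact: measure_ge0. Qed.

Let lebesgue_tuple_sigma_additive n : semi_sigma_additive (@lebesgue_tuple n).
Proof.
by have [m <-] := lebesgue_tuple_measure n; exact: measure_semi_sigma_additive.
Qed.

HB.instance Definition _ n := isMeasure.Build _ _ _ (@lebesgue_tuple n)
  (@lebesgue_tuple0 n) (@lebesgue_tuple_ge0 n)
  (@lebesgue_tuple_sigma_additive n).

Let lebesgue_tuple_sigma_finite n : sigma_finite setT (@lebesgue_tuple n).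
Proof. by have [m <-] := lebesgue_tuple_measure n; exact: sigma_finiteT. Qed.

HB.instance Definition _ n := Measure_isSigmaFinite.Build _ _ _
  (@lebesgue_tuple n) (@lebesgue_tuple_sigma_finite n).

End lebesgue_tuple.

Section unit_cube.
Variables (R : realType) (s : nat).

Definition cube : set (s.-tuple R) := [set x | forall j, 0 <= tnth x j <= 1].

Definition half_open_cube : set (s.-tuple R) :=
  [set x | forall j, 0 <= tnth x j < 1].

(** [(x_u, 1)] *)
Definition anchor (u : {set 'I_s}) (x : s.-tuple R) : s.-tuple R :=
  [tuple if j \in u then tnth x j else 1 | j < s].

(** Weights are indexed from 1, coordinates from 0; [gamma 0] is never used. *)
Definition product_weight (gamma : nat -> R) (u : {set 'I_s}) : R :=
  \prod_(j in u) gamma j.+1.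

End unit_cube.
Arguments cube {R} s.
Arguments half_open_cube {R} s.

Section star_discrepancy.
Variables (R : realType) (s N : nat).

(** A point set is a multiset, given as an indexed family. *)
Definition local_discrepancy (P : 'I_N -> s.-tuple R) (alpha : s.-tuple R) : R :=
  #|[pred n | [forall j, 0 <= tnth (P n) j < tnth alpha j]]|%:R / N%:R
  - \prod_(j < s) tnth alpha j.

(** Each supremum is over a nonempty set bounded by 1, and the maximum is over
    nonnegative numbers, so that 0 is harmless as its neutral element. *)
Definition weighted_star_discrepancy (gamma : nat -> R)
    (P : 'I_N -> s.-tuple R) : R :=
  \big[Num.max/0]_(u : {set 'I_s} | u != finset.set0)
    (product_weight gamma u *
     sup [set `|local_discrepancy P (anchor u alpha)| | alpha in cube s]).

End star_discrepancy.

Section F1.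
Variables (R : realType) (s : nat).
Let mu := @lebesgue_tuple R s.

(** The alternating sum over the corners of the box [[a_u, b_u]]
    of [x_u |-> f (x_u, 1)]. *)
Definition increment (f : s.-tuple R -> R) (u : {set 'I_s})
    (a b : s.-tuple R) : R :=
  \sum_(v : {set 'I_s} | v \subset u) (-1) ^+ #|v| *
    f (anchor u [tuple if j \in v then tnth a j else tnth b j | j < s]).

(** [x_u |-> g (x_u, 1)] is integrable and is the mixed derivative
    [d^|u| f / d x_u (x_u, 1)], in the sense of absolute continuity: the
    increment of [x_u |-> f (x_u, 1)] over every box is the integral of the
    derivative over that box. For [u = {j}] this says that [f (x_j, 1)] is an
    absolutely continuous function of [x_j] with a.e. derivative [g (x_j, 1)].
    An integral over [[0,1]^|u|] is written as an integral over [[0,1]^s] of a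
    function of [x_u] only. *)
Definition is_mixed_derivative (f : s.-tuple R -> R) (u : {set 'I_s})
    (g : s.-tuple R -> R) : Prop :=
  mu.-integrable (cube s) (EFin \o (g \o anchor u)) /\
  forall a b : s.-tuple R, cube s a -> cube s b ->
    (forall j, tnth a j <= tnth b j) ->
    increment f u a b =
    \int[mu]_(x in cube s `&`
                   [set x | forall j, j \in u -> tnth a j <= tnth x j <= tnth b j])
      g (anchor u x).

(** Unique almost everywhere when it exists. *)
Definition mixed_derivative (f : s.-tuple R -> R) (u : {set 'I_s}) :
    s.-tuple R -> R :=
  xget (fun=> 0) [set g | is_mixed_derivative f u g].

Definition F1 (gamma : nat -> R) : set (s.-tuple R -> R) :=
  [set f | forall u : {set 'I_s}, u != finset.set0 ->
    (exists g, is_mixed_derivative f u g) /\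
    (product_weight gamma u = 0 -> is_mixed_derivative f u (fun=> 0))].

(** As [0^-1 = 0], the terms with weight 0 vanish. *)
Definition F1_norm (gamma : nat -> R) (f : s.-tuple R -> R) : R :=
  `|f [tuple 1 | _ < s]| +
  \sum_(u : {set 'I_s} | u != finset.set0) (product_weight gamma u)^-1 *
    \int[mu]_(x in cube s) `|mixed_derivative f u (anchor u x)|.

Definition F1_unit_ball (gamma : nat -> R) : set (s.-tuple R -> R) :=
  [set f | F1 gamma f /\ F1_norm gamma f <= 1].

End F1.

Section integration_error.
Variables (R : realType) (s N : nat).
Implicit Types (B : set (s.-tuple R -> R)) (w : 'I_N -> R)
  (x : 'I_N -> s.-tuple R).

Definition integration_rule w x (f : s.-tuple R -> R) : R :=
  \sum_(n < N) w n * f (x n).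

(** [B] is the unit ball of the function space. *)
Definition worst_case_error B w x : \bar R :=
  ereal_sup [set `|\int[@lebesgue_tuple R s]_(y in cube s) f y
                    - integration_rule w x f|%:E | f in B].

Definition minimal_error B : \bar R :=
  ereal_inf [set worst_case_error B p.1 p.2 |
    p in [set p : ('I_N -> R) * ('I_N -> s.-tuple R) |
            forall n, cube s (p.2 n)]].

End integration_error.

Section tractability.
Variable R : realType.

(** The least [N >= 1] with [Q N], and [+oo] if there is none. *)
Definition least_size (Q : nat -> Prop) : \bar R :=
  ereal_inf [set N%:R%:E | N in [set N | (0 < N)%N /\ Q N]].

Definition discrepancy_complexity (gamma : nat -> R) (eps : R) (s : nat) : \bar R :=
  least_size (fun N => exists P : 'I_N -> s.-tuple R,
    (forall n, half_open_cube s (P n)) /\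
    weighted_star_discrepancy gamma P <= eps).

Definition F1_complexity (gamma : nat -> R) (eps : R) (s : nat) : \bar R :=
  least_size (fun N => (@minimal_error R s N (F1_unit_ball gamma) <= eps%:E)%E).

(** [Ncomp eps s] is an information complexity. *)
Definition strong_tractability_bound (Ncomp : R -> nat -> \bar R) (C tau : R) : Prop :=
  forall (s : nat) (eps : R), (0 < s)%N -> 0 < eps < 1 ->
    (Ncomp eps s <= (C * eps `^ (- tau))%:E)%E.

Definition strongly_polynomially_tractable (Ncomp : R -> nat -> \bar R) : Prop :=
  exists C tau : R, [/\ 0 <= C, 0 <= tau & strong_tractability_bound Ncomp C tau].

Definition tractability_exponent (Ncomp : R -> nat -> \bar R) : \bar R :=
  ereal_inf [set tau%:E | tau in [set tau | 0 <= tau /\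
    exists2 C, 0 <= C & strong_tractability_bound Ncomp C tau]].

End tractability.

(* Main.v *)
Require Import Defs.
From mathcomp Require Import all_boot all_order all_algebra.
From mathcomp Require Import all_classical all_reals all_analysis measurable_realfun.
From mathcomp Require Import ring lra zify.

Set Implicit Arguments.
Unset Strict Implicit.
Unset Printing Implicit Defensive.

Import Order.TTheory GRing.Theory Num.Theory.
Import numFieldNormedType.Exports.

Local Open Scope classical_set_scope.
Local Open Scope ring_scope.

(** The hypothesis on the upper limit forces [delta > 0] and [j * gamma j <= 1]
    for all large [j]. Under these two facts point sets with weighted star
    discrepancy of order [sqrt (ln N / N)], uniformly in the dimension [s],
    exist; since [ln N = O (N ^ (2 * delta))], [N = O (eps ^ (- tau))] points
    with [tau = 2 / (1 - 2 * delta)] reach the accuracy [eps].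

    The points lie on the grid [{0, 1/N, ..., (N-1)/N}^s] and are chosen one
    after the other, a derandomized form of the Hoeffding inequality with a
    union bound ([balancing]). Each test box, given by a set [u] of active
    coordinates and a corner on the grid, carries the weight
    [prod_(j in u) 1 / ((N + 1) * j * (j + 2))], so that the total weight is
    bounded independently of [s] and [N], and a weighted sum of suitably
    normalized exponentials of the signed deviations does not increase if the
    next point is well chosen.
    Hence the deviation of every test box is at most a constant times
    [sqrt (ln N / N) * prod_(j in u) (2 * sqrt j)] ([grid_points]). Rounding
    to the grid extends this to all boxes anchored at the origin, with or
    without their upper faces ([low_deviation_points]). As
    [2 * gamma j * sqrt j <= 1] for all large [j], the weights
    [prod_(j in u) gamma j] absorb the product over [u]
    ([weighted_growth_bounded]).

    For integration in [F1] the same points are used with equal weights.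
    Inclusion-exclusion over the projections writes [f x] as [f 1] plus a signed
    sum over [u] of integrals of the mixed derivatives over the boxes [[x_u, 1]]
    ([upper_integral_representation]). By Fubini the quadrature error becomes
    the integral of the mixed derivatives against the deviations of the closed
    boxes ([upper_integral_error]), which gives a Koksma-Hlawka inequality
    ([quadrature_error_le]). *)

(** * Balancing finitely many test functions *)

Section balancing.
Variable R : realType.

Lemma expR_le_quadratic (y : R) :
  `|y| <= 2^-1 -> expR y <= 1 + y + 2 * y ^+ 2.
Proof.
rewrite ler_norml => /andP[y1 y2].
have e0 := expR_gt0 (- y).
have h := expR_ge1Dx (- y).
have y3 : y ^+ 2 * (1 - 2 * y) >= 0 by rewrite mulr_ge0 ?sqr_ge0//; lra.
have q0 : 0 < 1 + y + 2 * y ^+ 2 by have := sqr_ge0 y; lra.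
rewrite -[y in expR y]opprK expRN invf_ple ?posrE//.
apply: le_trans h; rewrite -[leLHS]mul1r ler_pdivrMr// -subr_ge0.
by rewrite [leRHS](_ : _ = y ^+ 2 * (1 - 2 * y))//; ring.
Qed.

(** Points can be chosen one by one so that the weighted exponential moments of
    all the sums [\sum_k h t (p k)], corrected by the Hoeffding factor
    [expR (- 2 * lam t ^+ 2)] for each point, stay below their initial value:
    the average over the next point of the increased potential does not exceed
    the current one. *)
Lemma balancing (T X : finType) (h : T -> X -> R) (w lam : T -> R) (x0 : X) :
  (forall t, 0 <= w t) -> (forall t, `|lam t| <= 2^-1) ->
  (forall t x, `|h t x| <= 1) -> (forall t, \sum_x h t x = 0) ->
  forall n, exists p : nat -> X,
    \sum_t w t * expR (lam t * (\sum_(k < n) h t (p k)) - 2 * n%:R * lam t ^+ 2)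
      <= \sum_t w t.
Proof.
move=> w0 lam1 h1 hs; elim=> [|n [p IH]].
  exists (fun=> x0); apply: ler_sum => t _.
  by rewrite big_ord0 !mulr0 mul0r subr0 expR0 mulr1.
pose E t := expR (lam t * (\sum_(k < n) h t (p k)) - 2 * n%:R * lam t ^+ 2).
pose G x := \sum_t w t * E t * expR (lam t * h t x - 2 * lam t ^+ 2).
(* the factor contributed by the next point has average at most [1] *)
have avg t : \sum_x expR (lam t * h t x - 2 * lam t ^+ 2) <= #|X|%:R.
  have -> : \sum_x expR (lam t * h t x - 2 * lam t ^+ 2) =
      (\sum_x expR (lam t * h t x)) / expR (2 * lam t ^+ 2).
    by rewrite mulr_suml; apply: eq_bigr => x _; rewrite expRD expRN.
  rewrite ler_pdivrMr ?expR_gt0//.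
  apply: (@le_trans _ _ (\sum_x (1 + lam t * h t x + 2 * lam t ^+ 2))).
    apply: ler_sum => x _.
    have hh : `|lam t * h t x| <= 2^-1.
      by rewrite normrM -[leRHS]mulr1 ler_pM.
    apply: (le_trans (expR_le_quadratic hh)); rewrite lerD2l ler_pM2l//.
    rewrite exprMn -[leRHS]mulr1 ler_wpM2l ?sqr_ge0//.
    by rewrite -real_normK ?num_real// exprn_ile1.
  rewrite 2!big_split/= -mulr_sumr hs mulr0 addr0.
  rewrite !sumr_const -[X in _ + X]mulr_natl -[X in X + _]mulr1.
  by rewrite -mulrDr ler_wpM2l// expR_ge1Dx.
have X0 : (0 < #|X|)%N by apply/card_gt0P; exists x0.
have [x Gx] : exists x, G x <= \sum_t w t * E t.
  apply: contrapT => /forallNP Gx.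
  suff : \sum_x G x < \sum_x G x by rewrite ltxx.
  apply: (@le_lt_trans _ _ (\sum_(x : X) \sum_t w t * E t)).
    rewrite /G exchange_big/= sumr_const -[leRHS]mulr_natl mulr_sumr.
    apply: ler_sum => t _; rewrite -mulr_sumr mulrC ler_wpM2r//.
    by rewrite mulr_ge0// expR_ge0.
  apply: ltr_sum; first by apply/hasP; exists x0 => //; exact: mem_index_enum.
  by move=> x _; rewrite ltNge; apply/negP/Gx.
exists (fun k => if k == n then x else p k).
apply: le_trans IH; apply: le_trans Gx; apply: ler_sum => t _.
rewrite big_ord_recr/= eqxx -(mulrA (w t)) ler_wpM2l// /E -expRD ler_expR.
rewrite (eq_bigr (fun k : 'I_n => h t (p k))); last first.
  by move=> k _; rewrite ltn_eqF.
by rewrite -natr1; lra.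
Qed.

End balancing.

(** * Test boxes and their cost *)

Section grid.
Variable R : realType.

(** Growth of the deviation bound with the set [u] of active coordinates; the
    coordinates are counted from 0, whence [j.+1]. *)
Definition growth (s : nat) (u : {set 'I_s}) : R :=
  \prod_(j in u) (2 * Num.sqrt j.+1%:R).

(** Loss against the rate [N ^ (-1/2)]. The summand 3 covers the factors
    other than [N + 1] in [cost_bound]. *)
Definition log_loss (N : nat) : R := ln N.+1%:R + 3.

Lemma log_loss_ge3 N : 3 <= log_loss N.
Proof. by rewrite /log_loss lerDr ln_ge0// ler1n. Qed.

Lemma growth_ge1 s (u : {set 'I_s}) : 1 <= growth u.
Proof.
rewrite /growth; elim/big_ind : _ => // [x y|j _]; first exact: mulr_ege1.
by rewrite mulr_ege1 ?ler1n// -[leLHS]sqrtr1 ler_wsqrtr// ler1n.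
Qed.

Lemma growth_sqr s (u : {set 'I_s}) :
  growth u ^+ 2 = \prod_(j in u) (4 * j.+1%:R).
Proof.
rewrite /growth -prodrXl; apply: eq_bigr => j _.
by rewrite exprMn sqr_sqrtr//; congr (_ * _); rewrite -natrX.
Qed.

(** The product is the reciprocal of the weight of a test box with active
    coordinates [u]; the factor 4 bounds the total weight of all signed test
    boxes. *)
Lemma cost_bound (s N : nat) (u : {set 'I_s}) :
  4 * \prod_(j in u) (N.+1%:R * (j.+1%:R * j.+3%:R)) <=
  expR (log_loss N * growth u ^+ 2).
Proof.
have L3 := log_loss_ge3 N; have L0 : 0 <= log_loss N by lra.
rewrite growth_sqr.
suff : [/\ 0 <= \prod_(j in u) (N.+1%:R * (j.+1%:R * j.+3%:R)) :> R,
  1 <= \prod_(j in u) (4 * j.+1%:R : R) &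
  4 * \prod_(j in u) (N.+1%:R * (j.+1%:R * j.+3%:R)) <=
  expR (log_loss N * \prod_(j in u) (4 * j.+1%:R))] by case.
elim/big_rec2 : _ => [|j W P _ [P0 W1 IH]].
  by split=> //; rewrite !mulr1; have := expR_ge1Dx (log_loss N); lra.
have D4 : 4 <= 4 * j.+1%:R :> R by rewrite -[leLHS]mulr1 ler_wpM2l// ler1n.
split; [by rewrite !mulr_ge0 | by nra |].
have -> : 4 * (N.+1%:R * (j.+1%:R * j.+3%:R) * P) =
  (N.+1%:R * (j.+1%:R * j.+3%:R)) * (4 * P) by ring.
have step : N.+1%:R * (j.+1%:R * j.+3%:R) <=
    expR (log_loss N * (4 * j.+1%:R - 1)) :> R.
  have -> : log_loss N * (4 * j.+1%:R - 1) =
    ln N.+1%:R + (ln N.+1%:R * (4 * j.+1%:R - 2) + 3 * (4 * j.+1%:R - 1)).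
    by rewrite /log_loss; ring.
  rewrite expRD lnK ?posrE// ler_wpM2l//.
  apply: (@le_trans _ _ (expR j%:R * expR j.+2%:R)).
    by rewrite ler_pM//; apply: le_trans (expR_ge1Dx _); rewrite nat1r.
  rewrite -expRD ler_expR.
  have l0 : 0 <= ln N.+1%:R :> R by rewrite ln_ge0// ler1n.
  have : 0 <= ln N.+1%:R * (4 * j.+1%:R - 2) :> R by rewrite mulr_ge0//; lra.
  by have : 0 <= j%:R :> R by []; rewrite -!natr1; lra.
apply: (@le_trans _ _ (expR (log_loss N * (4 * j.+1%:R - 1)) *
                       expR (log_loss N * W))).
  by apply: ler_pM => //; rewrite !mulr_ge0.
rewrite -expRD ler_expR -mulrDr ler_wpM2l//.
by nra.
Qed.

Lemma sum_lt_ord (N a : nat) : (\sum_(i < N) (i < a)%N = minn a N)%N.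
Proof.
elim: N => [|N IH]; first by rewrite big_ord0 minn0.
by rewrite big_ord_recr/= IH; case: ltnP => h; lia.
Qed.

End grid.

(** * Points on a grid *)

Section grid_points.
Variable R : realType.

Lemma sum_ffun_lt (s N : nat) (a : 'I_s -> nat) :
  \sum_(x : {ffun 'I_s -> 'I_N}) \prod_j (x j < a j)%N%:R =
  \prod_j (minn (a j) N)%:R :> R.
Proof.
rewrite -(bigA_distr_bigA (fun (j : 'I_s) (i : 'I_N) => (i < a j)%N%:R)) /=.
by apply: eq_bigr => j _; rewrite -sum_lt_ord natr_sum.
Qed.

Lemma telescoping_prod (s : nat) :
  \prod_(j < s) (1 + (j.+1%:R * j.+3%:R)^-1) = 2 * s.+1%:R / s.+2%:R :> R.
Proof.
elim: s => [|s IH]; first by rewrite big_ord0 mulr1 divff.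
rewrite big_ord_recr/= IH -!natr1; have : 0 <= s%:R :> R by [].
by move=> s0; field; rewrite !gt_eqF//; lra.
Qed.

(** Weight of the test box with side lengths [f j / N], where the value
    [f j = N + 1] marks an inactive coordinate. *)
Definition test_weight (s N : nat) (f : {ffun 'I_s -> 'I_N.+2}) : R :=
  \prod_j (if (f j <= N)%N then (N.+1%:R * (j.+1%:R * j.+3%:R))^-1 else 1).

Lemma sum_test_weight (s N : nat) :
  \sum_f @test_weight s N f <= 2.
Proof.
rewrite /test_weight.
rewrite -(bigA_distr_bigA (fun (j : 'I_s) (o : 'I_N.+2) =>
  if (o <= N)%N then (N.+1%:R * (j.+1%:R * j.+3%:R))^-1 else 1)) /=.
rewrite (eq_bigr (fun j : 'I_s => 1 + (j.+1%:R * j.+3%:R)^-1)).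
  rewrite telescoping_prod ler_pdivrMr// ler_pM2l// ler_nat//.
move=> j _; rewrite big_ord_recr/= ltnn addrC; congr (_ + _).
rewrite (eq_bigr (fun=> (N.+1%:R * (j.+1%:R * j.+3%:R))^-1)); last first.
  by move=> i _; rewrite -ltnS ltn_ord.
by rewrite sumr_const card_ord -[LHS]mulr_natl invfM mulrA divff// mul1r.
Qed.

(** Order of the deviation of [N] points in a box with active coordinates [u]. *)
Definition grid_bound (s N : nat) (u : {set 'I_s}) : R :=
  Num.sqrt (log_loss R N / N%:R) * growth R u.

Lemma prod_bool (I : finType) (P b : pred I) :
  \prod_(j | P j) (b j)%:R = [forall (j | P j), b j]%:R :> R.
Proof.
case: forallP => [h|/forallP]; first by rewrite big1// => j /(implyP (h j)) ->.
by move=> /forallPn[j]; rewrite negb_imply => /andP[Pj /negbTE bj];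
  rewrite (bigD1 j)//= bj mul0r.
Qed.

(** Simultaneous bound for all boxes whose corner lies on the grid. *)
Lemma grid_points (s N : nat) : (0 < N)%N ->
  exists p : 'I_N -> {ffun 'I_s -> 'I_N},
    forall (u : {set 'I_s}) (a : 'I_s -> nat), (forall j, (a j <= N)%N) ->
    `| #|[pred n | [forall j in u, p n j < a j]%N]|%:R / N%:R
       - \prod_(j in u) ((a j)%:R / N%:R) | <= 3 * grid_bound N u.
Proof.
move=> N0; have N0R : 0 < N%:R :> R by rewrite ltr0n.
pose X := {ffun 'I_s -> 'I_N}; pose F := {ffun 'I_s -> 'I_N.+2}.
pose vol (f : F) : R := \prod_j ((minn (f j) N)%:R / N%:R).
pose ind (f : F) (x : X) : R := \prod_j (x j < f j)%N%:R.
pose act (f : F) := [set j | (f j <= N)%N]%SET.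
pose G (f : F) := grid_bound N (act f).
pose lam (f : F) : R := if G f <= 1 then G f / 2 else 0.
have G0 f : 0 < G f.
  rewrite mulr_gt0 ?(lt_le_trans ltr01 (growth_ge1 _ _))// sqrtr_gt0 divr_gt0//.
  by have := log_loss_ge3 R N; lra.
have vol01 f : 0 <= vol f <= 1.
  apply/andP; split; first by apply: prodr_ge0 => j _; rewrite divr_ge0.
  apply: prodr_ile1 => j _; rewrite divr_ge0//= ler_pdivrMr// mul1r ler_nat.
  exact: geq_minr.
have ind01 f x : 0 <= ind f x <= 1.
  by rewrite /ind prod_bool ler0n lern1 leq_b1.
pose h (t : F * bool) x := ind t.1 x - vol t.1.
have h1 t x : `|h t x| <= 1.
  by rewrite ler_norml; move: (vol01 t.1) (ind01 t.1 x); rewrite /h; lra.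
have hs t : \sum_x h t x = 0.
  rewrite /h sumrB sum_ffun_lt sumr_const card_ffun !card_ord.
  rewrite /vol big_split/= prodr_const card_ord exprVn -[X in _ - X]mulr_natr natrX.
  by rewrite mulfVK ?subrr// expf_neq0// gt_eqF.
pose lamt (t : F * bool) := if t.2 then lam t.1 else - lam t.1.
have lam1 t : `|lamt t| <= 2^-1.
  rewrite /lamt /lam; have := G0 t.1.
  case: t.2; case: ifPn => [|_]; rewrite ?oppr0 ?normr0//.
    by move=> ? ?; rewrite ger0_norm; lra.
  by move=> ? ?; rewrite normrN ger0_norm; lra.
pose w (t : F * bool) := test_weight t.1.
have w0 f : 0 < @test_weight s N f.
  by apply: prodr_gt0 => j _; case: ifP => // _; rewrite invr_gt0 !mulr_gt0.
have x0 : X := [ffun=> Ordinal N0].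
have [p ple] := balancing x0 (fun t => ltW (w0 t.1)) lam1 h1 hs N.
exists (fun n => p n) => u a aN.
pose f : F := [ffun j => if j \in u then inord (a j) else ord_max].
have fu : act f = u.
  apply/setP => j; rewrite inE ffunE; case: ifPn => [_|_] /=; last by rewrite ltnn.
  by rewrite inordK ?aN// ltnS leqW.
have volE : vol f = \prod_(j in u) ((a j)%:R / N%:R).
  rewrite /vol [RHS]big_mkcond/=; apply: eq_bigr => j _; rewrite ffunE.
  case: ifPn => ju; last by rewrite /= (minn_idPr _)// divff// gt_eqF.
  by rewrite inordK ?ltnS ?leqW// (minn_idPl _).
have indE x : ind f x = [forall j in u, x j < a j]%N%:R.
  rewrite -prod_bool /ind [RHS]big_mkcond/=; apply: eq_bigr => j _.
  rewrite ffunE; case: ifPn => ju; first by rewrite inordK ?ltnS ?leqW.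
  by rewrite /= ltnS ltnW.
have cardE : #|[pred n : 'I_N | [forall j in u, p n j < a j]%N]|%:R =
    \sum_(n < N) ind f (p n).
  by rewrite -sum1_card big_mkcond/= natr_sum; apply: eq_bigr => n _; rewrite indE inE; case: ifP.
rewrite -volE cardE -fu -/(G f).
have -> : (\sum_(n < N) ind f (p n)) / N%:R - vol f =
    (\sum_(n < N) h (f, true) (p n)) / N%:R.
  rewrite /h sumrB sumr_const card_ord/= mulrBl -[X in _ = _ - X / _]mulr_natr mulfK//.
  by rewrite gt_eqF.
set S := \sum_(n < N) _.
rewrite normrM normfV (ger0_norm (ltW N0R)) ler_pdivrMr//.
have [G1|G1] := leP (G f) 1; last first.
  (* the trivial bound suffices *)
  apply: (@le_trans _ _ N%:R); last by nra.
  apply: le_trans (ler_norm_sum _ _ _) _.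
  have -> : N%:R = \sum_(n < N) 1 :> R by rewrite sumr_const card_ord.
  exact: ler_sum.
(* a single term of the potential is at most the total weight, which is at most
   [4]; the choice [lam f = G f / 2] balances the two contributions *)
have side (b : bool) : lamt (f, b) * S <= 3 / 2 * (N%:R * G f ^+ 2).
  have GE : N%:R * G f ^+ 2 = log_loss R N * growth R u ^+ 2.
    rewrite /G fu exprMn sqr_sqrtr; last first.
      by rewrite divr_ge0//; have := log_loss_ge3 R N; lra.
    by field; rewrite gt_eqF.
  have l2 : lamt (f, b) ^+ 2 = G f ^+ 2 / 4.
    by rewrite /lamt /lam/= G1; case: b; field.
  suff : expR (lamt (f, b) * S - 2 * N%:R * lamt (f, b) ^+ 2) <=
      expR (N%:R * G f ^+ 2) by rewrite ler_expR l2; lra.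
  rewrite GE; apply: le_trans (cost_bound R N u).
  have wE : test_weight f =
      (\prod_(j in u) (N.+1%:R * (j.+1%:R * j.+3%:R)))^-1.
    rewrite -prodfV [RHS]big_mkcond/=; apply: eq_bigr => j _.
    by rewrite -fu inE.
  rewrite -ler_pdivrMr; last by rewrite -invr_gt0 -wE.
  rewrite -wE mulrC.
  have : \sum_t w t <= 4.
    rewrite -(pair_bigA _ (fun f b => w (f, b)))/= exchange_big/= big_bool/=.
    by have := sum_test_weight s N; rewrite /w/=; lra.
  apply: le_trans; apply: le_trans ple.
  by rewrite [leRHS](bigD1 (f, b))//= lerDl sumr_ge0// => t _;
    rewrite mulr_ge0 ?expR_ge0// ltW.
have := side true; have := side false; rewrite /lamt /lam/= G1 => s1 s2.
have G0f := G0 f.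
by rewrite ler_norml; apply/andP; split; rewrite -(ler_pM2l G0f); lra.
Qed.
End grid_points.

(** * Arbitrary boxes and the rate of convergence *)

Section boxes.
Variable R : realType.

(** Thresholding the grid [{0, 1/N, ..., (N-1)/N}] at [alpha], with either a
    strict or a large inequality, is a rounding of [alpha] to the grid. *)
Lemma grid_rounding (N : nat) (alpha : R) (q : pred nat) :
  (0 < N)%N -> 0 <= alpha <= 1 ->
  (forall i, i%:R / N%:R < alpha -> q i) ->
  (forall i, q i -> i%:R / N%:R <= alpha) ->
  (forall i k, (i <= k)%N -> q k -> q i) ->
  exists a : nat, [/\ (a <= N)%N, (forall i, (i < N)%N -> q i = (i < a)%N) &
    `|a%:R / N%:R - alpha| <= N%:R^-1].
Proof.
move=> N0 /andP[al0 al1] q1 q2 qd; have N0R : 0 < N%:R :> R by rewrite ltr0n.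
have stop : exists i, ~~ q i || (N <= i)%N by exists N; rewrite leqnn orbT.
case: (ex_minnP stop) => a ha amin.
have qa i : (i < a)%N -> q i.
  move=> ia; apply: contraTT ia => nqi; rewrite -leqNgt.
  by apply: amin; rewrite nqi.
have aN : (a <= N)%N by apply: amin; rewrite leqnn orbT.
exists a; split=> //.
  move=> i iN; apply/idP/idP => [qi|]; last exact: qa.
  rewrite ltnNge; apply/negP => ai; move: ha; rewrite (qd _ _ ai qi)/=.
  by move=> Na; move: (leq_trans Na ai); rewrite leqNgt iN.
have lo : a%:R / N%:R <= alpha + N%:R^-1.
  case: a ha amin qa aN => [|a] _ _ qa _; first by rewrite mul0r addr_ge0.
  by rewrite -natr1 mulrDl mul1r lerD2r q2// qa.
have hi : alpha <= a%:R / N%:R.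
  move: ha => /orP[nq|Na]; first by rewrite leNgt; apply: contra nq => /q1.
  have -> : a = N by apply/eqP; rewrite eqn_leq aN.
  by rewrite divff// gt_eqF.
by rewrite ler_norml; have : 0 <= N%:R^-1 :> R by []; lra.
Qed.

Lemma prod_dist_le (I : finType) (P : pred I) (a b : I -> R) :
  (forall i, 0 <= a i <= 1) -> (forall i, 0 <= b i <= 1) ->
  `|\prod_(i | P i) a i - \prod_(i | P i) b i| <= \sum_(i | P i) `|a i - b i|.
Proof.
move=> a01 b01.
suff : [/\ 0 <= \prod_(i | P i) a i <= 1, 0 <= \prod_(i | P i) b i <= 1 &
  `|\prod_(i | P i) a i - \prod_(i | P i) b i| <= \sum_(i | P i) `|a i - b i|].
  by case.
elim/big_rec3 : _ => [|i S B A _ [A01 B01 AB]].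
  by split; rewrite ?ler01 ?lexx ?subrr ?normr0.
have := a01 i; have := b01 i => b1 a1.
split; [by apply/andP; split; nra| by apply/andP; split; nra|].
have -> : a i * A - b i * B = (a i - b i) * A + b i * (A - B) by ring.
apply: (le_trans (ler_normD _ _)); rewrite !normrM lerD//.
  by rewrite -[leRHS]mulr1 ler_wpM2l// ler_norml; lra.
apply: le_trans AB; rewrite -[leRHS]mul1r ler_wpM2r// ler_norml; lra.
Qed.

Lemma card_le_growth s (u : {set 'I_s}) : #|u|%:R <= growth R u.
Proof.
apply: (@le_trans _ _ (2 ^+ #|u|)).
  by rewrite -natrX ler_nat ltnW// ltn_expl.
rewrite -prodr_const; apply: ler_prod => j _; rewrite ler0n/=.
by rewrite -[leLHS]mulr1 ler_wpM2l// -[leLHS]sqrtr1 ler_wsqrtr// ler1n.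
Qed.

(** Local discrepancy in the projection onto the coordinates in [u] of the box
    with corners [0] and [alpha]. With [r] the relation [<%R] the box does not
    contain its upper faces, with [<=%R] it does. The points are assumed to have
    nonnegative coordinates, so that the lower faces need no test. *)
Definition box_deviation (s N : nat) (r : rel R) (x : 'I_N -> s.-tuple R)
    (u : {set 'I_s}) (alpha : 'I_s -> R) : R :=
  #|[pred n | [forall j in u, r (tnth (x n) j) (alpha j)]]|%:R / N%:R
  - \prod_(j in u) alpha j.

Lemma low_deviation_points (s N : nat) : (0 < N)%N ->
  exists x : 'I_N -> s.-tuple R, (forall n, half_open_cube s (x n)) /\
    forall (r : rel R) u alpha, r = <=%R \/ r = <%R ->
      (forall j, 0 <= alpha j <= 1) ->
      `|box_deviation r x u alpha| <= 4 * grid_bound R N u.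
Proof.
move=> N0; have N0R : 0 < N%:R :> R by rewrite ltr0n.
have [p hp] := grid_points R s N0.
exists (fun n => [tuple (p n j)%:R / N%:R | j < s]); split.
  move=> n j; rewrite tnth_mktuple divr_ge0//= ltr_pdivrMr// mul1r ltr_nat.
  exact: ltn_ord.
move=> r u al hr al01.
have rnd j : exists a : nat, [/\ (a <= N)%N,
    (forall i, (i < N)%N -> r (i%:R / N%:R) (al j) = (i < a)%N) &
    `|a%:R / N%:R - al j| <= N%:R^-1].
  apply: (@grid_rounding N _ (fun i => r (i%:R / N%:R) (al j))) => // [i|i|i k ik].
  - by case: hr => ->// /ltW.
  - by case: hr => ->// /ltW.
  - have ik' : i%:R / N%:R <= k%:R / N%:R :> R.
      by rewrite ler_pM2r ?invr_gt0// ler_nat.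
    by case: hr => ->; [exact: le_trans|exact: le_lt_trans].
have /choice[a ha] := rnd.
have aN j : (a j <= N)%N by case: (ha j).
have := hp u a aN; rewrite /box_deviation.
have -> : #|[pred n | [forall j in u, p n j < a j]%N]| =
    #|[pred n | [forall j in u,
       r (tnth [tuple (p n j)%:R / N%:R | j < s] j) (al j)]]|.
  apply: eq_card => n; rewrite !inE; apply: eq_forallb => j.
  by rewrite tnth_mktuple; case: (ha j) => _ -> .
set c := _ / N%:R; set A := \prod_(j in u) _; set B := \prod_(j in u) al j.
move=> h1.
have h2 : `|A - B| <= grid_bound R N u.
  apply: le_trans (prod_dist_le _ _ al01) _ => [j|].
    by rewrite divr_ge0//= ler_pdivrMr// mul1r ler_nat.
  apply: (@le_trans _ _ (\sum_(j in u) N%:R^-1)).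
    by apply: ler_sum => j _; case: (ha j).
  rewrite sumr_const -[leLHS]mulr_natr ler_pM ?card_le_growth//.
  rewrite -[leLHS]ger0_norm ?invr_ge0// -sqrtr_sqr ler_wsqrtr//.
  rewrite expr2 ler_wpM2r ?invr_ge0//.
  apply: (@le_trans _ _ 1); first by rewrite invf_le1// ler1n.
  by have := log_loss_ge3 R N; lra.
have -> : c - B = (c - A) + (A - B) by ring.
apply: le_trans (ler_normD _ _) _; lra.
Qed.

End boxes.

Section rate.
Variable R : realType.

(** Only the finitely many coordinates with [2 * gamma j * sqrt j > 1] contribute
    to the bound. *)
Lemma weighted_growth_bounded (gamma : nat -> R) (J : nat) :
  (forall j, (1 <= j)%N -> 0 <= gamma j) ->
  (forall j, (J <= j)%N -> j%:R * gamma j <= 1) ->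
  exists2 K : R, 0 < K &
    forall s (u : {set 'I_s}), product_weight gamma u * growth R u <= K.
Proof.
move=> g0 gJ.
pose c j : R := Num.max 1 (gamma j.+1 * (2 * Num.sqrt j.+1%:R)).
have c1 j : 1 <= c j by rewrite /c le_max lexx.
have c0 j : 0 <= c j by apply: le_trans (c1 j).
pose m := (J + 4)%N.
have cm j : (m <= j)%N -> c j = 1.
  move=> mj; apply/max_idPl.
  have gj : j.+1%:R * gamma j.+1 <= 1 by apply: gJ; rewrite /m in mj; lia.
  set q := Num.sqrt _.
  have qq : q * q = j.+1%:R by rewrite -expr2 sqr_sqrtr.
  have q2 : 2 <= q.
    have -> : 2 = Num.sqrt (2 ^+ 2) :> R by rewrite sqrtr_sqr ger0_norm.
    by rewrite ler_wsqrtr// -natrX ler_nat; rewrite /m in mj; lia.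
  (* [j >= 4] makes [q >= 2], and [q * (q * gamma j) <= 1] *)
  rewrite -qq in gj; have gj0 := g0 j.+1 isT; nra.
exists (\prod_(j < m) c j) => [|s u].
  by apply: prodr_gt0 => j _; exact: lt_le_trans (c1 j).
rewrite /product_weight /growth -big_split/=.
apply: (@le_trans _ _ (\prod_(j < s) c j)).
  rewrite big_mkcond; apply: ler_prod => j _.
  case: ifPn => _; last by rewrite ler01 c1.
  by rewrite !mulr_ge0 ?g0//= /c le_max lexx orbT.
apply: (@le_trans _ _ (\prod_(j < m + s) c j)).
  rewrite addnC big_split_ord/= -[leLHS]mulr1 ler_wpM2l//.
    by apply: prodr_ge0.
  by elim/big_ind : _ => // x y; exact: mulr_ege1.
rewrite big_split_ord/= [X in _ * X]big1 ?mulr1// => j _.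
by rewrite cm// leq_addr.
Qed.

Lemma log_loss_le (eta : R) (N : nat) : 0 < eta < 1 -> (0 < N)%N ->
  log_loss R N <= (2 / eta + 3) * N%:R `^ eta.
Proof.
move=> /andP[e0 e1] N0; have N1 : 1 <= N%:R :> R by rewrite ler1n.
have P1 : 1 <= N%:R `^ eta :> R by rewrite -[leLHS](powRr0 N%:R) ler_powR// ltW.
have l1 : ln N.+1%:R <= (N.+1%:R `^ eta) / eta :> R.
  by rewrite ler_pdivlMr// mulrC -ln_powR ltW// ln_sublinear// powR_gt0.
have l2 : N.+1%:R `^ eta <= 2 * N%:R `^ eta :> R.
  apply: (@le_trans _ _ ((2 * N%:R) `^ eta)).
    apply: ge0_ler_powR; rewrite ?nnegrE ?mulr_ge0//; first exact: ltW.
    by rewrite -natr1; lra.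
  rewrite powRM// ler_wpM2r ?powR_ge0// -[leRHS]powRr1//.
  by rewrite ler_powR ?ler1n// ltW.
rewrite /log_loss mulrDl lerD//; last by lra.
apply: le_trans l1 _; rewrite mulrAC ler_wpM2r// invr_ge0 ltW//.
Qed.

Lemma sufficient_size (K delta : R) : 0 < K -> 0 < delta < 1 / 2 ->
  exists2 C : R, 0 <= C & forall eps, 0 < eps < 1 ->
    exists N : nat, [/\ (0 < N)%N, K * Num.sqrt (log_loss R N / N%:R) <= eps &
      N%:R <= C * eps `^ (- (2 / (1 - 2 * delta)))].
Proof.
move=> K0 /andP[d0 d1]; pose eta := 2 * delta.
have eta01 : 0 < eta < 1 by rewrite /eta; lra.
pose B := K ^+ 2 * (2 / eta + 3).
have B0 : 0 < B.
  rewrite mulr_gt0 ?exprn_gt0// addr_gt0// divr_gt0//; by case/andP: eta01.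
pose th : R := 1 - eta; have th0 : 0 < th by rewrite /th; lra.
(* the size solves [B * N ^ (eta - 1) = eps ^ 2] up to rounding *)
pose D := B `^ th^-1; have D0 : 0 < D by rewrite powR_gt0.
exists (D + 1) => [|eps /andP[e0 e1]]; first by rewrite addr_ge0// ltW.
rewrite -/eta -/th.
pose X := D * eps `^ (- (2 / th)).
have E1 : 1 <= eps `^ (- (2 / th)).
  rewrite powRN -[leLHS]invr1 lef_pV2 ?posrE ?powR_gt0//.
  apply: (@le_trans _ _ (1 `^ (2 / th))); last by rewrite powR1.
  rewrite ge0_ler_powR ?nnegrE ?(ltW e0) ?(ltW e1)//.
  by rewrite divr_ge0// ltW.
have X0 : 0 <= X by rewrite mulr_ge0 ?powR_ge0// ltW.
pose N := (Num.truncn X).+1.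
have NX : X <= N%:R by rewrite ltW// truncnS_gt.
have N0 : 0 < N%:R :> R by rewrite ltr0n.
exists N; split=> //; last first.
  rewrite mulrDl mul1r /N -natr1 lerD// -/X.
  by rewrite truncn_le.
have Nth : B * eps ^- 2 <= N%:R `^ th.
  apply: (@le_trans _ _ (X `^ th)); last first.
    by apply: ge0_ler_powR; rewrite ?nnegrE// ltW.
  rewrite /X powRM ?powR_ge0// ?(ltW D0)// /D -!powRrM mulVf ?gt_eqF// powRr1 ?(ltW B0)//.
  by rewrite mulNr divfK ?gt_eqF// powRN powR_mulrn// ltW.
rewrite -(ger0_norm (ltW K0)) -sqrtr_sqr -sqrtrM ?sqr_ge0//.
rewrite -[leRHS](ger0_norm (ltW e0)) -sqrtr_sqr ler_wsqrtr//.
rewrite mulrA ler_pdivrMr//.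
apply: (@le_trans _ _ (B * N%:R `^ eta)).
  by rewrite /B -mulrA ler_wpM2l ?sqr_ge0// log_loss_le.
have NE : N%:R = N%:R `^ eta * N%:R `^ th :> R.
  rewrite -powRD; last by apply/implyP => _; rewrite gt_eqF.
  by rewrite (_ : eta + th = 1) ?powRr1//; rewrite /th; ring.
rewrite [X in _ <= _ * X]NE mulrCA mulrC ler_wpM2l ?powR_ge0//.
by move: Nth; rewrite ler_pdivrMr ?exprn_gt0// mulrC.
Qed.

End rate.

(** * Weighted star discrepancy and tractability *)

Section uniform_point_sets.
Variable R : realType.

(** All boxes anchored at the origin, with or without their upper faces, are
    sampled with weighted error at most [eps] in every projection. *)
Definition weighted_deviation_le (s N : nat) (gamma : nat -> R)
    (x : 'I_N -> s.-tuple R) (eps : R) : Prop :=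
  forall (r : rel R) (u : {set 'I_s}) alpha, r = <=%R \/ r = <%R ->
    (forall j, 0 <= alpha j <= 1) ->
    product_weight gamma u * `|box_deviation r x u alpha| <= eps.

Lemma product_weight_ge0 (s : nat) (gamma : nat -> R) (u : {set 'I_s}) :
  (forall j, (1 <= j)%N -> 0 <= gamma j) -> 0 <= product_weight gamma u.
Proof. by move=> g0; apply: prodr_ge0 => j _; exact: g0. Qed.

Lemma good_point_sets (gamma : nat -> R) (J : nat) (delta : R) :
  (forall j, (1 <= j)%N -> 0 <= gamma j) ->
  (forall j, (J <= j)%N -> j%:R * gamma j <= 1) ->
  0 < delta < 1 / 2 ->
  exists2 C : R, 0 <= C & forall s eps, 0 < eps < 1 ->
    exists N : nat, [/\ (0 < N)%N, N%:R <= C * eps `^ (- (2 / (1 - 2 * delta))) &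
      exists x : 'I_N -> s.-tuple R, (forall n, half_open_cube s (x n)) /\
        weighted_deviation_le gamma x eps].
Proof.
move=> g0 gJ d01; have [K K0 hK] := weighted_growth_bounded g0 gJ.
have K40 : 0 < 4 * K by rewrite mulr_gt0.
have [C C0 hC] := sufficient_size K40 d01.
exists C => // s eps e01; have [N [N0 Neps NC]] := hC _ e01.
exists N; split=> //; have [x [xin xdev]] := low_deviation_points R s N0.
exists x; split=> // r u alpha hr al01.
apply: le_trans Neps; have w0 := product_weight_ge0 u g0.
apply: le_trans (ler_wpM2l w0 (xdev r u alpha hr al01)) _.
rewrite /grid_bound; set q := Num.sqrt _.
have -> : product_weight gamma u * (4 * (q * growth R u)) =
  4 * (product_weight gamma u * growth R u) * q by ring.
by rewrite ler_wpM2r ?sqrtr_ge0// ler_wpM2l.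
Qed.

Lemma prod_anchor (s : nat) (u : {set 'I_s}) (alpha : s.-tuple R) :
  \prod_(j < s) tnth (anchor u alpha) j = \prod_(j in u) tnth alpha j.
Proof.
by rewrite [RHS]big_mkcond; apply: eq_bigr => j _; rewrite tnth_mktuple.
Qed.

Lemma local_discrepancy_anchor (s N : nat) (x : 'I_N -> s.-tuple R)
    (u : {set 'I_s}) (alpha : s.-tuple R) :
  (forall n, half_open_cube s (x n)) ->
  local_discrepancy x (anchor u alpha) = box_deviation <%R x u (tnth alpha).
Proof.
move=> xin; rewrite /local_discrepancy /box_deviation prod_anchor.
congr (_%:R / _ - _); apply: eq_card => n; rewrite !inE.
apply: eq_forallb => j; rewrite tnth_mktuple.
by have /andP[-> x1] := xin n j; case: ifP => //=; rewrite x1.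
Qed.

Lemma weighted_star_discrepancy_le (s N : nat) (gamma : nat -> R)
    (x : 'I_N -> s.-tuple R) (eps : R) :
  (forall j, (1 <= j)%N -> 0 <= gamma j) -> 0 <= eps ->
  (forall n, half_open_cube s (x n)) -> weighted_deviation_le gamma x eps ->
  weighted_star_discrepancy gamma x <= eps.
Proof.
move=> g0 e0 xin xdev; apply: bigmax_le => // u _.
have w0 := product_weight_ge0 u g0.
have [->|wN0] := eqVneq (product_weight gamma u) 0; first by rewrite mul0r.
have wp : 0 < product_weight gamma u by rewrite lt_def wN0.
rewrite mulrC -ler_pdivlMr//; apply: ge_sup.
  by exists `|local_discrepancy x (anchor u [tuple 0 | _ < s])|;
    exists [tuple 0 | _ < s] => // j; rewrite tnth_mktuple lexx ler01.
move=> _ [alpha al01 <-]; rewrite local_discrepancy_anchor// ler_pdivlMr//.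
by rewrite mulrC; apply: xdev => //; right.
Qed.

Lemma least_size_le (Q : nat -> Prop) (N : nat) :
  (0 < N)%N -> Q N -> (least_size R Q <= N%:R%:E)%E.
Proof. by move=> N0 QN; apply: ereal_inf_lbound; exists N. Qed.

Lemma tractable_of_bound (Ncomp : R -> nat -> \bar R) (C tau : R) :
  0 <= C -> 0 <= tau -> strong_tractability_bound Ncomp C tau ->
  strongly_polynomially_tractable Ncomp /\
  (tractability_exponent Ncomp <= tau%:E)%E.
Proof.
move=> C0 t0 h; split; first by exists C, tau.
by apply: ereal_inf_lbound; exists tau => //; split=> //; exists C.
Qed.

Lemma limsup_lt_eventually (u : nat -> R) (l : R) :
  (limn_esup (fun j => (u j)%:E) < l%:E)%E ->
  exists J, forall j, (J <= j)%N -> u j <= l.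
Proof.
move=> /ereal_inf_lt[_ [A [J _ JA] <-] hA]; exists J => j Jj.
rewrite -lee_fin; apply: le_trans (ltW hA); apply: ereal_sup_ubound.
by exists j => //; exact: JA.
Qed.

End uniform_point_sets.

(** * Volumes and orders of integration in the cube *)

Section cube_measure.
Variable R : realType.

(** The box with opposite corners [0] and [b]. *)
Definition corner_box (s : nat) (b : 'I_s -> R) : set (s.-tuple R) :=
  [set x | forall j, 0 <= tnth x j <= b j].

Lemma measurable_forall_ord d (T : measurableType d) (s : nat)
    (P : 'I_s -> set T) :
  (forall j, measurable (P j)) -> measurable [set x | forall j, P j x].
Proof.
move=> mP; rewrite (_ : [set x | _] = \bigcap_(j in [set: 'I_s]) P j).
  by apply: fin_bigcap_measurable => //; exact: finite_finset.
by apply/seteqP; split=> x /= h j; [move=> _|]; exact: h.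
Qed.

Lemma measurable_coord_box (s : nat) (a b : 'I_s -> R) :
  measurable [set x : s.-tuple R | forall j, a j <= tnth x j <= b j].
Proof.
apply: measurable_forall_ord => j.
rewrite (_ : (fun x => _) = (fun x : s.-tuple R => tnth x j) @^-1` `[a j, b j]%classic).
  rewrite -[X in measurable X]setTI.
  by apply: (measurable_tnth j) => //; exact: measurable_itv.
by apply/seteqP; split => x /=; rewrite in_itv.
Qed.

Lemma measurable_cube (s : nat) : measurable (cube s : set (s.-tuple R)).
Proof. exact: measurable_coord_box. Qed.

Lemma lebesgue_tuple_corner_box (s : nat) (b : 'I_s -> R) :
  (forall j, 0 <= b j) ->
  lebesgue_tuple (corner_box b) = (\prod_j b j)%:E.
Proof.
elim: s b => [|s IH] b b0.
  rewrite big_ord0 /= diracE mem_set// => j; by case: j.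
have IHb := IH (fun j => b (lift ord0 j)) (fun j => b0 _).
rewrite /= /pushforward.
rewrite (_ : _ @^-1` _ = `[0, b ord0]%classic `*`
   corner_box (fun j => b (lift ord0 j))).
  rewrite [LHS](@product_measure1E _ _ _ _ _ lebesgue_measure)//=; last first.
    exact: measurable_coord_box.
  rewrite lebesgue_measure_itv/= IHb big_ord_recl/= EFinM; congr (_ * _)%E.
  rewrite lte_fin; case: ltP => [_|]; first by rewrite oppr0 adde0.
  by move=> bn; congr EFin; apply/eqP; rewrite eq_le b0 bn.
apply/seteqP; split => -[y x] /=.
  rewrite /corner_box/= => h; split.
    by have := h ord0; rewrite in_itv/= tnth0.
  by move=> j; have := h (lift ord0 j); rewrite tnthS.
rewrite in_itv/= => -[hy hx] j.
case: (unliftP ord0 j) => [k ->|->]; last by rewrite tnth0.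
by rewrite tnthS.
Qed.

End cube_measure.

Section fubini_upper_box.
Variables (R : realType) (s : nat).
Let mu := @lebesgue_tuple R s.
Implicit Types (u : {set 'I_s}) (x y : s.-tuple R) (g : s.-tuple R -> R).

(** The points of the cube that dominate [x] in the coordinates of [u]. *)
Definition upper_box u x : set (s.-tuple R) :=
  cube s `&` [set y | forall j, j \in u -> tnth x j <= tnth y j].

Lemma measurable_upper_box u x : measurable (upper_box u x).
Proof.
apply: measurableI; first exact: measurable_cube.
apply: measurable_forall_ord => j; case: (boolP (j \in u)) => ju; last first.
  by rewrite (_ : (fun _ => _) = setT)//; apply/seteqP; split=> // y _.
rewrite (_ : (fun _ => _) = (fun y => tnth y j) @^-1` `[tnth x j, +oo[%classic).
  rewrite -[X in measurable X]setTI.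
  by apply: (measurable_tnth j) => //; exact: measurable_itv.
by apply/seteqP; split => y /=; rewrite in_itv/= andbT //; apply.
Qed.

(** The pairs [(x, y)] with [x] in the cube and [x_u <= y_u]. *)
Lemma measurable_dominance u :
  measurable [set z : s.-tuple R * s.-tuple R |
    cube s z.1 /\ forall j, j \in u -> tnth z.1 j <= tnth z.2 j].
Proof.
rewrite (_ : [set z | _] = (fst @^-1` cube s) `&`
  [set z | forall j, j \in u -> tnth z.1 j <= tnth z.2 j]); last first.
  by apply/seteqP; split => z.
apply: measurableI.
  rewrite -[X in measurable X]setTI.
  by apply: measurable_fst => //; exact: measurable_cube.
apply: measurable_forall_ord => j; case: (boolP (j \in u)) => ju; last first.
  by rewrite (_ : (fun _ => _) = setT)//; apply/seteqP; split=> // y _.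
rewrite (_ : (fun _ => _) =
  setT `&` [set z : s.-tuple R * s.-tuple R | tnth z.1 j <= tnth z.2 j]).
  apply: measurable_fun_le => //.
    by apply: measurableT_comp (measurable_tnth j) _; exact: measurable_fst.
  by apply: measurableT_comp (measurable_tnth j) _; exact: measurable_snd.
by apply/seteqP; split => z /=; [move=> h; split=> //; exact: h|case].
Qed.

Lemma measurable_prod_coord u :
  measurable_fun setT (fun y => \prod_(j in u) tnth y j).
Proof.
rewrite (_ : (fun _ => _) = fun y => \prod_(j <- enum u) tnth y j).
  by apply: measurable_prod => j _; exact: measurable_tnth.
by apply/funext => y; rewrite big_enum.
Qed.

Lemma prod_coord_ge0_le1 u y : cube s y -> 0 <= \prod_(j in u) tnth y j <= 1.
Proof.
move=> yc; apply/andP; split; last by apply: prodr_ile1 => j _; exact: yc.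
by apply: prodr_ge0 => j _; case/andP: (yc j).
Qed.

Lemma integrable_mul_bounded g (h : s.-tuple R -> R) : mu.-integrable (cube s) (EFin \o g) ->
  measurable_fun setT h -> (forall y, cube s y -> `|h y| <= 1) ->
  mu.-integrable (cube s) (EFin \o (fun y => g y * h y)).
Proof.
move=> gint mh h1; have mC := @measurable_cube R s.
apply: (le_integrable mC _ _ gint).
  apply/measurable_EFinP; apply: measurable_funM; last exact: measurable_funTS.
  by apply/measurable_EFinP; exact: measurable_int gint.
move=> y yc /=; rewrite lee_fin normrM -[leRHS]mulr1 ler_wpM2l//.
exact: h1.
Qed.

(** Volume of the points of the cube that [y] dominates in the coordinates of
    [u], times a factor [c] that may vanish when [y] is outside the cube. *)
Lemma integral_dominated u y (c : R) : cube s y \/ c = 0 ->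
  (\int[mu]_x (c * \1_[set z : s.-tuple R * s.-tuple R | cube s z.1 /\
      forall j, j \in u -> tnth z.1 j <= tnth z.2 j] (x, y))%:E =
   (c * \prod_(j in u) tnth y j)%:E)%E.
Proof.
move=> [yc|->]; last first.
  under eq_integral do rewrite mul0r.
  by rewrite mul0r integral0.
pose b j := if j \in u then tnth y j else 1.
have b0 j : 0 <= b j by rewrite /b; case: ifP => // _; case/andP: (yc j).
have -> : \prod_(j in u) tnth y j = \prod_j b j by rewrite [LHS]big_mkcond.
have mb : measurable (corner_box b) by exact: measurable_coord_box.
rewrite EFinM -(lebesgue_tuple_corner_box b0) -integral_cst//.
rewrite [RHS]integral_mkcond; apply: eq_integral => x _.
rewrite patchE indicE.
suff -> : ((x, y) \in [set z : s.-tuple R * s.-tuple R | cube s z.1 /\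
    forall j, j \in u -> tnth z.1 j <= tnth z.2 j]) = (x \in corner_box b).
  by case: ifP => _; rewrite ?mulr1 ?mulr0.
apply/idP/idP; rewrite !inE/=.
  move=> [xc xy] j; have /andP[x0 x1] := xc j.
  by rewrite x0 /b; case: ifP => // /xy.
move=> xb; split=> [j|j ju]; have := xb j; rewrite /b.
  move=> /andP[-> xj]/=; apply: le_trans xj _; case: ifP => // _.
  by case/andP: (yc j).
by rewrite ju => /andP[].
Qed.

(** Exchange of the order of integration over the pairs with [x_u <= y_u]. *)
Lemma integral_upper_box u g :
  mu.-integrable (cube s) (EFin \o g) ->
  mu.-integrable (cube s) (EFin \o (fun x => \int[mu]_(y in upper_box u x) g y)) /\
  \int[mu]_(x in cube s) (\int[mu]_(y in upper_box u x) g y) =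
  \int[mu]_(y in cube s) (g y * \prod_(j in u) tnth y j).
Proof.
move=> gint; have mC := @measurable_cube R s.
pose E := [set z : s.-tuple R * s.-tuple R |
    cube s z.1 /\ forall j, j \in u -> tnth z.1 j <= tnth z.2 j].
have mE : measurable E := measurable_dominance u.
pose k z : \bar R := ((g \_ (cube s)) z.2 * \1_E z)%:E.
have g'int : mu.-integrable setT (EFin \o g \_ (cube s)).
  by rewrite -restrict_EFin; apply/(integrable_mkcond _ mC).
have mg' : measurable_fun setT (g \_ (cube s)).
  by apply/measurable_EFinP; exact: measurable_int g'int.
have gout y : cube s y \/ (g \_ (cube s)) y = 0.
  by have [yc|/negP yc] := boolP (y \in cube s); [left; rewrite inE in yc|
    right; rewrite patchE; case: ifP].
have mk : measurable_fun setT k.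
  apply/measurable_EFinP; apply: measurable_funM.
    by apply: measurableT_comp mg' _; exact: measurable_snd.
  exact: measurable_indic.
have kint : (mu \x mu)%E.-integrable setT k.
  apply/(integrable21ltyP mu mu mk).
  rewrite (eq_integral (fun y => (`|(g \_ (cube s)) y| * \prod_(j in u) tnth y j)%:E)).
    have : mu.-integrable setT
        (EFin \o (fun y => g y * \prod_(j in u) tnth y j) \_ (cube s)).
      rewrite -restrict_EFin; apply/(integrable_mkcond _ mC).
      apply: integrable_mul_bounded => //; first exact: measurable_prod_coord.
      by move=> y /(prod_coord_ge0_le1 u)/andP[p0 p1]; rewrite ger0_norm.
    set v := EFin \o _ => /integrableP[_].
    rewrite (eq_integral (fun y => `|v y|%E))// => y _.
    rewrite /v/= !patchE; congr EFin.
    case: ifPn => [|_]; last by rewrite normr0 mul0r.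
    rewrite inE normrM => /(prod_coord_ge0_le1 u)/andP[p0 _].
    by rewrite [`|\prod_(_ in _) _|]ger0_norm.
  move=> y _; rewrite -integral_dominated.
    apply: eq_integral => x _.
    by rewrite /k/= normrM [`|\1_E _|]ger0_norm.
  by have [?|->] := gout y; [left|right; rewrite normr0].
have Fx x : cube s x -> fubini_F mu k x = (\int[mu]_(y in upper_box u x) g y)%:E.
  move=> xc; rewrite /Rintegral fineK; last first.
    apply: integrable_fin_num; first exact: measurable_upper_box.
    by apply: (integrableS mC _ _ gint); [exact: measurable_upper_box|move=> y []].
  rewrite [RHS]integral_mkcond; apply: eq_integral => y _.
  rewrite /k patchE/= patchE indicE.
  have -> : (y \in upper_box u x) = (y \in cube s) && ((x, y) \in E).
    apply/idP/andP; rewrite !inE.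
      by move=> [yc xy].
    by move=> [yc [_ xy]].
  by case: ifP => _; [case: ((x, y) \in E); rewrite ?mulr1 ?mulr0|rewrite mul0r].
have FE : (fubini_F mu k) =
   (EFin \o (fun x => \int[mu]_(y in upper_box u x) g y)) \_ (cube s).
  apply/funext => x; rewrite patchE; case: ifPn => [xc|xc].
    by rewrite Fx// -inE.
  rewrite /fubini_F integral0_eq// => y _; rewrite /k indicE.
  suff -> : ((x, y) \in E) = false by rewrite mulr0.
  by apply/negbTE; apply: contra xc; rewrite !inE => -[].
have Fint := integrable_fubini_F kint; rewrite FE in Fint.
split; first by apply/(integrable_mkcond _ mC).
rewrite /Rintegral; congr fine.
rewrite [LHS]integral_mkcond -FE (Fubini kint) [RHS]integral_mkcond.
apply: eq_integral => y _; rewrite patchE.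
rewrite (integral_dominated _ (gout y)) patchE.
by case: ifP => // _; rewrite mul0r.
Qed.

End fubini_upper_box.

(** * Integration in [F1] *)

Section moebius.
Variables (R : realType) (s : nat).
Implicit Types (f : s.-tuple R -> R) (u v : {set 'I_s}) (x : s.-tuple R).

Let ones : s.-tuple R := [tuple 1 | _ < s].

Lemma increment_ones f u x : increment f u x ones =
  \sum_(v : {set 'I_s} | v \subset u) (-1) ^+ #|v| * f (anchor v x).
Proof.
apply: eq_bigr => v vu; congr (_ * f _); apply: eq_from_tnth => j.
rewrite !tnth_mktuple; case: (boolP (j \in v)) => [jv|_]; last by case: ifP.
by rewrite (fintype.subsetP vu).
Qed.

Lemma signed_supersets v :
  \sum_(u : {set 'I_s} | v \subset u) (-1) ^+ #|u| =
  (v == [set: 'I_s]%SET)%:R * (-1) ^+ s :> R.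
Proof.
transitivity (\prod_(j < s) (-1 + (j \notin v)%:R) : R).
  rewrite bigA_distr [LHS]big_mkcond; apply: eq_big => [u|u _]; first by rewrite inE.
  case: ifPn => [vu|]; last first.
    case/fintype.subsetPn => j jv ju.
    by rewrite (bigD1 j)//= (negbTE ju) jv/= mul0r.
  rewrite -[LHS]prodr_const big_mkcond/=; apply: eq_bigr => j _.
  by case: ifPn => // ju; rewrite (contra (fintype.subsetP vu j) ju).
have [->|vT] := eqVneq v [set: 'I_s]%SET.
  rewrite mul1r -[in RHS](card_ord s) -prodr_const; apply: eq_bigr => j _.
  by rewrite inE addr0.
have : ~~ ([set: 'I_s]%SET \subset v) by rewrite finset.subTset.
case/fintype.subsetPn => j _ jv.
by rewrite (bigD1 j)//= jv addNr !mul0r.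
Qed.

(** Inclusion-exclusion over the projections recovers [f] from the increments
    of its anchored sections. *)
Lemma moebius_inversion f x :
  f x = \sum_(u : {set 'I_s}) (-1) ^+ #|u| * increment f u x ones.
Proof.
under eq_bigr => u _ do rewrite increment_ones mulr_sumr.
rewrite (exchange_big_dep xpredT)//=.
rewrite (eq_bigr (fun v => (v == [set: 'I_s]%SET)%:R *
    ((-1) ^+ s * ((-1) ^+ #|v| * f (anchor v x))))); last first.
  by move=> v _; rewrite -mulr_suml signed_supersets mulrA.
rewrite (bigD1 [set: 'I_s]%SET)//= eqxx mul1r big1 ?addr0; last first.
  by move=> v /negbTE ->; rewrite mul0r.
rewrite cardsT card_ord mulrA -expr2 sqrr_sign mul1r; congr f.
by apply: eq_from_tnth => j; rewrite tnth_mktuple inE.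
Qed.

Let mu := @lebesgue_tuple R s.

Lemma upper_integral_representation f (G : {set 'I_s} -> s.-tuple R -> R) x :
  (forall u, u != finset.set0 -> is_mixed_derivative f u (G u)) -> cube s x ->
  f x = f ones + \sum_(u : {set 'I_s} | u != finset.set0) (-1) ^+ #|u| *
    \int[mu]_(y in upper_box u x) G u (anchor u y).
Proof.
move=> fG xc; rewrite [LHS]moebius_inversion (bigD1 finset.set0)//=.
congr (_ + _).
  rewrite cards0 mul1r increment_ones (big_pred1 finset.set0) => [|v]; last first.
    by rewrite finset.subset0.
  rewrite cards0 mul1r; congr f; apply: eq_from_tnth => j.
  by rewrite !tnth_mktuple inE.
apply: eq_bigr => u u0; congr (_ * _).
have [_ ->//] := fG u u0.
- congr Rintegral; apply/seteqP; split => y [yc xy]; split=> // j ju.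
    by case/andP: (xy j ju).
  by rewrite tnth_mktuple xy//=; case/andP: (yc j).
- by move=> j; rewrite tnth_mktuple ler01 lexx.
- by move=> j; rewrite tnth_mktuple; case/andP: (xc j).
Qed.

End moebius.

Section quadrature.
Variables (R : realType) (s : nat).
Let mu := @lebesgue_tuple R s.
Implicit Types (u : {set 'I_s}) (g f : s.-tuple R -> R).

Lemma Rintegral_lincomb (I : Type) (r : seq I) (P : pred I) (c : I -> R)
    (h : I -> s.-tuple R -> R) :
  (forall i, P i -> mu.-integrable (cube s) (EFin \o h i)) ->
  mu.-integrable (cube s) (EFin \o (fun y => \sum_(i <- r | P i) c i * h i y)) /\
  \int[mu]_(y in cube s) (\sum_(i <- r | P i) c i * h i y) =
  \sum_(i <- r | P i) c i * \int[mu]_(y in cube s) h i y.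
Proof.
move=> hint; have mC := @measurable_cube R s.
elim: r => [|i r [IH1 IH2]].
  rewrite big_nil (_ : (fun y => _) = cst 0); last first.
    by apply/funext => y; rewrite big_nil.
  by split; [exact: integrable0|rewrite Rintegral_cst// mul0r].
rewrite big_cons; case: ifPn => Pi; last first.
  rewrite (_ : (fun y => _) = fun y => \sum_(i <- r | P i) c i * h i y)//.
  by apply/funext => y; rewrite big_cons (negbTE Pi).
rewrite (_ : (fun y => _) =
    fun y => c i * h i y + \sum_(i <- r | P i) c i * h i y); last first.
  by apply/funext => y; rewrite big_cons Pi.
have ci : mu.-integrable (cube s) (EFin \o (fun y => c i * h i y)).
  exact: (integrableZl mC (c i) (hint i Pi)).
split; first exact: (integrableD mC ci IH1).
by rewrite RintegralD// IH2 RintegralZl// hint.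
Qed.

Lemma norm_Rintegral_mul_le g (h : s.-tuple R -> R) (B : R) :
  mu.-integrable (cube s) (EFin \o g) ->
  mu.-integrable (cube s) (EFin \o (fun y => g y * h y)) ->
  (forall y, cube s y -> `|h y| <= B) ->
  `|\int[mu]_(y in cube s) (g y * h y)| <= B * \int[mu]_(y in cube s) `|g y|.
Proof.
move=> gint ghint hB; have mC := @measurable_cube R s.
have ngint : mu.-integrable (cube s) (EFin \o (fun y => `|g y|)).
  exact: integrable_norm gint.
apply: le_trans (le_normr_Rintegral mC ghint) _.
rewrite -RintegralZl//; apply: le_Rintegral => //.
- exact: integrable_norm ghint.
- exact: (integrableZl mC B ngint).
- by move=> y yc; rewrite normrM mulrC ler_wpM2r// hB.
Qed.

(** The equal-weight quadrature error of [x |-> \int_(y_u >= x_u) g] is the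
    integral of [g] against the deviation of the points. *)
Lemma upper_integral_error (N : nat) (x : 'I_N -> s.-tuple R) u g :
  mu.-integrable (cube s) (EFin \o g) ->
  let dev y := box_deviation <=%R x u (tnth y) in
  mu.-integrable (cube s) (EFin \o (fun y => g y * dev y)) /\
  \int[mu]_(z in cube s) (\int[mu]_(y in upper_box u z) g y) -
    \sum_(n < N) N%:R^-1 * (\int[mu]_(y in upper_box u (x n)) g y) =
  - \int[mu]_(y in cube s) (g y * dev y).
Proof.
move=> gint dev; have mC := @measurable_cube R s.
have mU n : measurable (upper_box u (x n)) by exact: measurable_upper_box.
have [_ ->] := integral_upper_box u gint.
pose ind n y : R := g y * \1_(upper_box u (x n)) y.
have indint n : mu.-integrable (cube s) (EFin \o ind n).
  apply: integrable_mul_bounded gint _ _; first exact: measurable_indic.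
  by move=> y _; rewrite indicE; case: (_ \in _); rewrite ?normr1 ?normr0.
have indE n : \int[mu]_(y in upper_box u (x n)) g y =
    \int[mu]_(y in cube s) ind n y.
  rewrite -[upper_box u (x n) in LHS](@setIidr _ (cube s)); last by move=> y [].
  rewrite Rintegral_mkcondr; apply: eq_Rintegral => y _.
  by rewrite patchE /ind indicE; case: ifP; rewrite ?mulr1 ?mulr0.
have pint : mu.-integrable (cube s)
    (EFin \o (fun y => g y * \prod_(j in u) tnth y j)).
  apply: integrable_mul_bounded gint _ _; first exact: measurable_prod_coord.
  by move=> y /(prod_coord_ge0_le1 u)/andP[p0 p1]; rewrite ger0_norm.
have [sint sE] := Rintegral_lincomb (index_enum 'I_N) (fun=> N%:R^-1)
  (fun n (_ : true) => indint n).
have devE y : cube s y -> g y * dev y =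
    (\sum_(n < N) N%:R^-1 * ind n y) - g y * \prod_(j in u) tnth y j.
  move=> yc; rewrite /dev /box_deviation mulrBr; congr (_ - _).
  rewrite -mulr_sumr [RHS]mulrC mulrA; congr (_ / _).
  rewrite -sum1_card big_mkcond/= natr_sum mulr_sumr; apply: eq_bigr => n _.
  rewrite /ind indicE inE; congr (_ * _).
  suff -> : (y \in upper_box u (x n)) =
      [forall j in u, tnth (x n) j <= tnth y j] by case: ifP.
  apply/idP/idP; rewrite inE.
    by move=> [_ xy]; apply/forallP => j; apply/implyP; exact: xy.
  by move=> /forallP xy; split=> // j /(implyP (xy j)).
split.
  apply: (eq_integrable mC _ _ _ (integrableB mC sint pint)) => y.
  by rewrite inE => yc /=; rewrite devE// EFinB.
rewrite (eq_bigr (fun n => N%:R^-1 * \int[mu]_(y in cube s) ind n y)); last first.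
  by move=> n _; rewrite indE.
rewrite -sE -opprB -RintegralB//; congr (- _).
by apply: eq_Rintegral => y; rewrite inE => yc; rewrite devE.
Qed.

(** Koksma-Hlawka inequality in [F1]. *)
Lemma quadrature_error_le (N : nat) (gamma : nat -> R) (x : 'I_N -> s.-tuple R)
    (eps : R) f :
  (forall j, (1 <= j)%N -> 0 <= gamma j) -> (0 < N)%N ->
  (forall n, cube s (x n)) -> weighted_deviation_le gamma x eps ->
  F1 gamma f ->
  `|\int[mu]_(y in cube s) f y - integration_rule (fun=> N%:R^-1) x f|
    <= eps * F1_norm gamma f.
Proof.
move=> g0 N0 xc xdev fF; have mC := @measurable_cube R s.
pose w u := product_weight gamma u; have w0 u : 0 <= w u.
  exact: product_weight_ge0.
(* the derivative vanishes where the weight does *)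
pose G u := if w u == 0 then fun=> 0 else mixed_derivative f u.
have GP u : u != finset.set0 -> is_mixed_derivative f u (G u).
  move=> u0; have [[g gP] fz] := fF u u0; rewrite /G.
  by case: eqP => [/fz//|_]; rewrite /mixed_derivative; case: xgetP => [h ->//|/(_ g)].
pose one : s.-tuple R := [tuple 1 | _ < s].
pose H u z := \int[mu]_(y in upper_box u z) G u (anchor u y).
have Gint u : u != finset.set0 ->
    mu.-integrable (cube s) (EFin \o (G u \o anchor u)) by move=> /GP[].
have Hint u : u != finset.set0 -> mu.-integrable (cube s) (EFin \o H u).
  by move=> /Gint/(integral_upper_box u)[].
have frep z : cube s z -> f z = f one +
    \sum_(u : {set 'I_s} | u != finset.set0) (-1) ^+ #|u| * H u z.
  exact: upper_integral_representation.
have [Sint SE] := Rintegral_lincomb (index_enum {set 'I_s})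
  (fun u => (-1) ^+ #|u|) Hint.
have cube1 : mu (cube s) = 1%E.
  have := @lebesgue_tuple_corner_box R s (fun=> 1) (fun=> ler01).
  by rewrite big1.
have intf : \int[mu]_(y in cube s) f y = f one +
    \sum_(u : {set 'I_s} | u != finset.set0) (-1) ^+ #|u| *
      \int[mu]_(y in cube s) H u y.
  rewrite -SE (@eq_Rintegral _ _ _ _ _ (fun z => f one +
    \sum_(u : {set 'I_s} | u != finset.set0) (-1) ^+ #|u| * H u z)).
    rewrite RintegralD//; last first.
      apply/integrableP; split; first exact: measurable_cst.
      rewrite (eq_integral (cst `|f one|%:E))// integral_cst// [X in (_ * X)%E]cube1 mule1.
      exact: ltry.
    by rewrite Rintegral_cst// [X in fine X]cube1 mulr1.
  by move=> z; rewrite inE; exact: frep.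
have rulef : integration_rule (fun=> N%:R^-1) x f = f one +
    \sum_(u : {set 'I_s} | u != finset.set0) (-1) ^+ #|u| *
      \sum_(n < N) N%:R^-1 * H u (x n).
  rewrite /integration_rule; under eq_bigr => n _ do rewrite frep// mulrDr.
  rewrite big_split/= sumr_const card_ord -[X in X + _]mulr_natr; congr (_ + _).
    by rewrite mulrAC mulVf ?mul1r// pnatr_eq0 -lt0n.
  under eq_bigr => n _ do rewrite mulr_sumr.
  rewrite exchange_big/=; apply: eq_bigr => u _.
  by rewrite mulr_sumr; apply: eq_bigr => n _; rewrite mulrCA.
rewrite intf rulef opprD addrACA subrr add0r -sumrB.
have e0 : 0 <= eps.
  have h01 : forall j : 'I_s, 0 <= (1 : R) <= 1 by move=> j; rewrite ler01 lexx.
  apply: le_trans (xdev <=%R finset.set0 (fun=> 1) (or_introl erefl) h01).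
  by rewrite mulr_ge0// w0.
apply: le_trans (ler_norm_sum _ _ _) _.
apply: (@le_trans _ _ (eps * \sum_(u : {set 'I_s} | u != finset.set0)
    (w u)^-1 * \int[mu]_(y in cube s) `|mixed_derivative f u (anchor u y)|));
  last by rewrite ler_wpM2l// lerDr.
rewrite mulr_sumr; apply: ler_sum => u u0.
rewrite -mulrBr normrM normr_sign mul1r.
have [dint dE] := upper_integral_error x u (Gint u u0).
rewrite [X in `|X|]dE normrN.
have [wz|wz] := eqVneq (w u) 0.
  rewrite wz invr0 mul0r mulr0 /G wz eqxx.
  rewrite (@eq_Rintegral _ _ _ _ _ (fun=> 0)) ?Rintegral_cst// ?mul0r ?normr0//.
  by move=> y _; rewrite /= mul0r.
have wp : 0 < w u by rewrite lt_def wz w0.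
apply: le_trans (norm_Rintegral_mul_le (B := eps / w u) (Gint u u0) dint _) _.
  by move=> y yc; rewrite ler_pdivlMr// mulrC; apply: xdev => //; left.
by rewrite mulrA /G (negbTE wz).
Qed.

Lemma minimal_error_le (N : nat) (gamma : nat -> R) (x : 'I_N -> s.-tuple R)
    (eps : R) :
  (forall j, (1 <= j)%N -> 0 <= gamma j) -> (0 < N)%N -> 0 <= eps ->
  (forall n, half_open_cube s (x n)) -> weighted_deviation_le gamma x eps ->
  (@minimal_error R s N (F1_unit_ball gamma) <= eps%:E)%E.
Proof.
move=> g0 N0 e0 xin xdev.
have xc n : cube s (x n) by move=> j; have /andP[-> /ltW] := xin n j.
apply: (@le_trans _ _ (worst_case_error (F1_unit_ball gamma)
    (fun=> N%:R^-1) x)).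
  by apply: ereal_inf_lbound; exists (fun=> N%:R^-1, x).
apply: ub_ereal_sup => _ [f [fF f1] <-]; rewrite lee_fin.
apply: le_trans (quadrature_error_le g0 N0 xc xdev fF) _.
by rewrite -[leRHS]mulr1 ler_wpM2l.
Qed.

End quadrature.

Theorem corollary1 (R : realType) (gamma : nat -> R) (delta : R)
  (gamma_ge0 : forall j : nat, (1 <= j)%N -> 0 <= gamma j)
  (gamma_noninc : forall j : nat, (1 <= j)%N -> gamma j.+1 <= gamma j)
  (delta_bounds : 0 <= delta < 1 / 2)
  (limsup_lt : (limn_esup (fun j : nat => (j%:R * gamma j)%:E) < (delta / 3)%:E)%E) :
  (strongly_polynomially_tractable (discrepancy_complexity gamma) /\
   (tractability_exponent (discrepancy_complexity gamma)
      <= (2 / (1 - 2 * delta))%:E)%E) /\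
  (strongly_polynomially_tractable (F1_complexity gamma) /\
   (tractability_exponent (F1_complexity gamma)
      <= (2 / (1 - 2 * delta))%:E)%E).
Proof.
have [J hJ] := limsup_lt_eventually limsup_lt.
have /andP[d0 d1] := delta_bounds.
have gJ j : (J <= j)%N -> j%:R * gamma j <= 1 by move=> /hJ; lra.
(* the terms of the sequence are nonnegative, so the strict bound on the upper
   limit excludes [delta = 0] *)
have dp : 0 < delta.
  have [_ [A [J' _ JA] <-] hA] := ereal_inf_lt limsup_lt.
  have : ((J'.+1%:R * gamma J'.+1)%:E < (delta / 3)%:E)%E.
    apply: le_lt_trans hA; apply: ereal_sup_ubound.
    by exists J'.+1 => //; apply: JA => /=.
  by have := mulr_ge0 (ler0n R J'.+1) (gamma_ge0 J'.+1 isT); rewrite lte_fin; lra.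
have dd : 0 < delta < 1 / 2 by rewrite dp d1.
have t0 : 0 <= 2 / (1 - 2 * delta) by rewrite divr_ge0//; lra.
have [C C0 hC] := good_point_sets gamma_ge0 gJ dd.
split; apply: (tractable_of_bound C0 t0) => s eps _ e01;
  have [N [N0 NC [x [xin xdev]]]] := hC s eps e01;
  have e0 : 0 <= eps by case/andP: e01 => /ltW.
- apply: (@le_trans _ _ N%:R%:E); last by rewrite lee_fin.
  apply: least_size_le => //.
  by exists x; split=> //; exact: weighted_star_discrepancy_le.
- apply: (@le_trans _ _ N%:R%:E); last by rewrite lee_fin.
  apply: least_size_le => //.
  exact: minimal_error_le xdev.
Qed.
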